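(* A variety of $\mathrm{FL}_{\mathrm e}$-algebras is semisimple if and only if it satisfies the equation $(1\wedge x)\vee(1\wedge\neg(1\wedge x)^n)\approx 1$ for some $n\in\omega$.
   Context: An $\mathrm{FL}_{\mathrm e}$-algebra is an algebra $\langle A,\wedge,\vee,\top,\bot,\cdot,1,\rightarrow,0\rangle$ such that $\langle A,\wedge,\vee,\top,\bot\rangle$ is a bounded lattice with top $\top$ and bottom $\bot$, $\langle A,\cdot,1\rangle$ is a commutative monoid, $x\cdot y\leq z$ iff $y\leq x\rightarrow z$, and $0$ is an arbitrary constant. Notation: $\neg x:=x\rightarrow\bot$, $x^0:=1$, $x^{n+1}:=x^n\cdot x$, and $\neg x^n$ means $\neg(x^n)$. A variety of $\mathrm{FL}_{\mathrm e}$-algebras is a class of $\mathrm{FL}_{\mathrm e}$-algebras axiomatized by equations. An algebra is simple if it has exactly two congruences; it is semisimple if it is a subdirect product of (a possibly empty family of) simple algebras, equivalently if the equality relation is the intersection of all maximal non-trivial congruences. A variety is semisimple if each algebra in it is semisimple. *)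

(* Defs.v *)
From Stdlib Require Import FunctionalExtensionality.
From mathcomp Require Import all_boot.

Set Implicit Arguments.
Unset Strict Implicit.
Unset Printing Implicit Defensive.

(* The lattice order is not part of the signature: x <= y is the equation
   meet x y = x, as in [residuation].  Nothing is assumed about [zero]. *)
Record FLe : Type := MkFLe {
  carrier :> Type;
  meet : carrier -> carrier -> carrier;
  join : carrier -> carrier -> carrier;
  top : carrier;
  bot : carrier;
  mul : carrier -> carrier -> carrier;
  one : carrier;
  imp : carrier -> carrier -> carrier;
  zero : carrier;
  meetA : associative meet;
  meetC : commutative meet;
  joinA : associative join;
  joinC : commutative join;
  meet_joinK : forall x y, meet x (join x y) = x;
  join_meetK : forall x y, join x (meet x y) = x;
  le_top : forall x, meet x top = x;
  bot_le : forall x, meet bot x = bot;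
  mulA : associative mul;
  mulC : commutative mul;
  mul1x : left_id one mul;
  residuation : forall x y z,
    meet (mul x y) z = mul x y <-> meet y (imp x z) = y
}.

Arguments meet {f} _ _.
Arguments join {f} _ _.
Arguments top {f}.
Arguments bot {f}.
Arguments mul {f} _ _.
Arguments one {f}.
Arguments imp {f} _ _.
Arguments zero {f}.

Inductive term : Type :=
  | Var of nat
  | Meet of term & term
  | Join of term & term
  | Top
  | Bot
  | Mul of term & term
  | One
  | Imp of term & term
  | Zero.

Definition Neg (t : term) : term := Imp t Bot.

Fixpoint Pow (t : term) (n : nat) : term :=
  if n is n'.+1 then Mul (Pow t n') t else One.

Definition equation : Type := (term * term)%type.

Fixpoint eval (A : FLe) (v : nat -> A) (t : term) : A :=
  match t with
  | Var i => v i
  | Meet s u => meet (eval v s) (eval v u)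
  | Join s u => join (eval v s) (eval v u)
  | Top => top
  | Bot => bot
  | Mul s u => mul (eval v s) (eval v u)
  | One => one
  | Imp s u => imp (eval v s) (eval v u)
  | Zero => zero
  end.

Definition satisfies (A : FLe) (e : equation) : Prop :=
  forall v : nat -> A, eval v e.1 = eval v e.2.

Definition is_variety (V : FLe -> Prop) : Prop :=
  exists E : equation -> Prop,
    forall A : FLe, V A <-> (forall e, E e -> satisfies A e).

Definition class_satisfies (V : FLe -> Prop) (e : equation) : Prop :=
  forall A : FLe, V A -> satisfies A e.

Definition compatible (T : Type) (R : T -> T -> Prop) (op : T -> T -> T) :
    Prop :=
  forall x x' y y', R x x' -> R y y' -> R (op x y) (op x' y').

Record congruence (A : FLe) (R : A -> A -> Prop) : Prop := MkCongruence {
  cong_refl : forall x, R x x;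
  cong_sym : forall x y, R x y -> R y x;
  cong_trans : forall x y z, R x y -> R y z -> R x z;
  cong_meet : compatible R meet;
  cong_join : compatible R join;
  cong_mul : compatible R mul;
  cong_imp : compatible R imp
}.

Definition same_rel (T : Type) (R S : T -> T -> Prop) : Prop :=
  forall x y, R x y <-> S x y.

(* Exactly two congruences; in particular a one-element algebra is not
   simple. *)
Definition simple (A : FLe) : Prop :=
  exists R S : A -> A -> Prop,
    [/\ congruence R, congruence S, ~ same_rel R S &
        forall Q : A -> A -> Prop,
          congruence Q -> same_rel Q R \/ same_rel Q S].

Record hom (A B : FLe) (f : A -> B) : Prop := MkHom {
  hom_meet : {morph f : x y / meet x y >-> meet x y};
  hom_join : {morph f : x y / join x y >-> join x y};
  hom_top : f top = top;
  hom_bot : f bot = bot;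
  hom_mul : {morph f : x y / mul x y >-> mul x y};
  hom_one : f one = one;
  hom_imp : {morph f : x y / imp x y >-> imp x y};
  hom_zero : f zero = zero
}.

Definition prodFLe (I : Type) (B : I -> FLe) : FLe.
Proof.
refine (@MkFLe (forall i, B i)
  (fun x y i => meet (x i) (y i)) (fun x y i => join (x i) (y i))
  (fun i => top) (fun i => bot)
  (fun x y i => mul (x i) (y i)) (fun i => one)
  (fun x y i => imp (x i) (y i)) (fun i => zero)
  _ _ _ _ _ _ _ _ _ _ _ _).
- by move=> x y z; apply: functional_extensionality_dep => i; apply: meetA.
- by move=> x y; apply: functional_extensionality_dep => i; apply: meetC.
- by move=> x y z; apply: functional_extensionality_dep => i; apply: joinA.
- by move=> x y; apply: functional_extensionality_dep => i; apply: joinC.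
- by move=> x y; apply: functional_extensionality_dep => i; apply: meet_joinK.
- by move=> x y; apply: functional_extensionality_dep => i; apply: join_meetK.
- by move=> x; apply: functional_extensionality_dep => i; apply: le_top.
- by move=> x; apply: functional_extensionality_dep => i; apply: bot_le.
- by move=> x y z; apply: functional_extensionality_dep => i; apply: mulA.
- by move=> x y; apply: functional_extensionality_dep => i; apply: mulC.
- by move=> x; apply: functional_extensionality_dep => i; apply: mul1x.
- move=> x y z; split=> le_xyz; apply: functional_extensionality_dep => i.
  + by apply/residuation; apply: (f_equal (fun u => u i) le_xyz).
  + by apply/residuation; apply: (f_equal (fun u => u i) le_xyz).
Defined.

(* [A] is isomorphic to a subalgebra of the product projecting onto every
   factor. *)
Definition subdirect_embedding (A : FLe) (I : Type) (B : I -> FLe)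
    (h : A -> prodFLe B) : Prop :=
  [/\ hom h, injective h & forall (i : I) (y : B i), exists x : A, h x i = y].

(* [I] may be empty: the one-element algebra is semisimple. *)
Definition semisimple (A : FLe) : Prop :=
  exists (I : Type) (B : I -> FLe) (h : A -> prodFLe B),
    (forall i, simple (B i)) /\ subdirect_embedding h.

Definition class_semisimple (V : FLe -> Prop) : Prop :=
  forall A : FLe, V A -> semisimple A.

(* (1 /\ x) \/ (1 /\ ~ ((1 /\ x) ^ n)) = 1 *)
Definition excluded_middle_eq (n : nat) : equation :=
  let e := Meet One (Var 0) in
  (Join e (Meet One (Neg (Pow e n))), One).

(* Main.v *)
From mathcomp Require Import all_boot boolp classical_sets.
Require Import Defs.

(** A multiplicatively closed set [M] of negative elements containing [1]
    yields the congruence [x ~ y <-> m x <= y and m y <= x for some m in M].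

    If all members of [V] are semisimple but every [excluded_middle_eq n] fails
    in some [A n] at some [a n], put [e n := 1 /\ a n] and
    [b n := e n \/ (1 /\ ~ (e n)^n)].  In the product of the [A n] modulo
    eventual equality, [e <= b] and [1 /\ ~ e^k <= b] for all [k].  In a simple
    algebra either [e = 1] or some [e^k] is [bot], so semisimplicity forces
    [1 <= b] there, i.e. [b n = 1] for large [n]: a contradiction.

    Conversely, for [a] not above [1], let [M] be maximal among the sets as
    above without elements below [a].  If [c <= 1] is not in [M], then
    [m c^k <= a] for some [m] in [M] and some [k]; since [c \/ d = 1] for
    [d := 1 /\ ~ c^n], the same cannot hold for [d], so [d] is in [M] and [c]
    generates the total congruence modulo [M]: the quotient is simple. *)

Set Implicit Arguments.
Unset Strict Implicit.
Unset Printing Implicit Defensive.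

(** * Order, residuation and powers of negative elements *)

Section Order.
Variable A : FLe.
Implicit Types x y z m : A.

Definition le x y : Prop := meet x y = x.

Lemma meetxx x : meet x x = x.
Proof. by rewrite -{2}(join_meetK x x) meet_joinK. Qed.

Lemma le_refl x : le x x. Proof. exact: meetxx. Qed.

Lemma le_trans y x z : le x y -> le y z -> le x z.
Proof. by rewrite /le => xy yz; rewrite -xy -meetA yz. Qed.

Lemma le_anti x y : le x y -> le y x -> x = y.
Proof. by rewrite /le => xy yx; rewrite -xy meetC. Qed.

Lemma meet_le_l x y : le (meet x y) x.
Proof. by rewrite /le meetC meetA meetxx. Qed.

Lemma meet_le_r x y : le (meet x y) y.
Proof. by rewrite /le -meetA meetxx. Qed.

Lemma le_meet x y z : le z x -> le z y -> le z (meet x y).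
Proof. by rewrite /le => zx zy; rewrite meetA zx. Qed.

Lemma le_join_l x y : le x (join x y).
Proof. exact: meet_joinK. Qed.

Lemma le_join_r x y : le y (join x y).
Proof. by rewrite joinC; exact: meet_joinK. Qed.

Lemma join_eqr x y : le x y -> join x y = y.
Proof. by move=> xy; rewrite -xy meetC joinC join_meetK. Qed.

Lemma join_le x y z : le x z -> le y z -> le (join x y) z.
Proof.
by move=> xz yz; rewrite -(join_eqr xz) -(join_eqr yz) joinA; exact: le_join_l.
Qed.

Lemma bot_min x : le bot x. Proof. exact: bot_le. Qed.

Lemma mulx1 x : mul x one = x. Proof. by rewrite mulC mul1x. Qed.

Lemma mulCA x y z : mul x (mul y z) = mul y (mul x z).
Proof. by rewrite !mulA (mulC x). Qed.

Lemma mulACA x y z t : mul (mul x y) (mul z t) = mul (mul x z) (mul y t).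
Proof. by rewrite -!mulA (mulCA y). Qed.

Lemma le_mul_imp x y z : le (mul x y) z <-> le y (imp x z).
Proof. exact: residuation. Qed.

Lemma mul_imp_le x y : le (mul x (imp x y)) y.
Proof. by apply/le_mul_imp; exact: le_refl. Qed.

Lemma mulx_bot x : mul x bot = bot.
Proof. by apply: le_anti (bot_min _); apply/le_mul_imp; exact: bot_min. Qed.

Lemma le_imp x y z : le y z -> le (imp x y) (imp x z).
Proof. by move=> yz; apply/le_mul_imp; apply: le_trans yz; exact: mul_imp_le. Qed.

Lemma le_mull x y z : le y z -> le (mul x y) (mul x z).
Proof.
by move=> yz; apply/le_mul_imp; apply: le_trans yz _; apply/le_mul_imp/le_refl.
Qed.

Lemma le_mul x y z t : le x y -> le z t -> le (mul x z) (mul y t).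
Proof.
move=> xy zt; apply: le_trans (le_mull _ zt) _.
by rewrite mulC (mulC y); exact: le_mull.
Qed.

Lemma mul_negl m x : le m one -> le (mul m x) x.
Proof. by move=> m1; rewrite -{2}(mul1x x); apply: le_mul => //; exact: le_refl. Qed.

Lemma mul_negr m x : le m one -> le (mul x m) x.
Proof. by rewrite mulC; exact: mul_negl. Qed.

Lemma mul_join_le x y z t :
  le (mul x y) t -> le (mul x z) t -> le (mul x (join y z)) t.
Proof. by move=> /le_mul_imp xy /le_mul_imp xz; apply/le_mul_imp/join_le. Qed.

Fixpoint pow x n : A := if n is n'.+1 then mul (pow x n') x else one.

Lemma powD x n p : pow x (n + p) = mul (pow x n) (pow x p).
Proof.
by elim: p => [|p IHp]; rewrite ?addn0 ?mulx1 // addnS /= IHp mulA.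
Qed.

Lemma pow_le1 x n : le x one -> le (pow x n) one.
Proof.
move=> x1; elim: n => [|n IHn] /=; first exact: le_refl.
exact: le_trans (mul_negr _ x1) IHn.
Qed.

Lemma le_pow x n p : le x one -> n <= p -> le (pow x p) (pow x n).
Proof.
by move=> x1 /subnKC <-; rewrite powD; apply: mul_negr; exact: pow_le1.
Qed.

(* Generalizes [c^k \/ d^l = 1] for negative [c], [d] with [c \/ d = 1] to
   arbitrary multiples and bounds, as the induction requires. *)
Lemma join1_pow_le c d f t k l :
  le c one -> le d one -> join c d = one ->
  le (mul f (pow c k)) t -> le (mul f (pow d l)) t -> le f t.
Proof.
move=> c1 d1 cd1; elim: k l f => [|k IHk] l f; first by rewrite /= mulx1.
elim: l f => [|l IHl] f fc fd; first by rewrite /= mulx1 in fd.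
(* In [f = f c \/ f d], the first joinand absorbs one factor [c] and lowers [k]; the second absorbs
   one [d] and lowers [l]. *)
rewrite -(mulx1 f) -cd1; apply: mul_join_le.
- apply: (IHk l.+1); first by rewrite -mulA (mulC c).
  by apply: le_trans fd; rewrite -mulA mulCA; exact: mul_negl.
- apply: IHl; last by rewrite -mulA (mulC d).
  by apply: le_trans fc; rewrite -mulA mulCA; exact: mul_negl.
Qed.

End Order.

(** * Congruences induced by monoids of negative elements *)

Section NegativeMonoid.
Variables (A : FLe) (M : A -> Prop).
Hypothesis M1 : M one.
Hypothesis MM : forall m m', M m -> M m' -> M (mul m m').
Hypothesis Mneg : forall m, M m -> le m one.

Definition monoid_rel (x y : A) : Prop :=
  exists m, [/\ M m, le (mul m x) y & le (mul m y) x].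

Lemma monoid_rel_sym x y : monoid_rel x y -> monoid_rel y x.
Proof. by move=> [m [Mm xy yx]]; exists m. Qed.

(** By symmetry of the relation, one inequality settles both. The premise [le (mul m y) x] serves
    [imp], which is antitone in its first argument. *)
Lemma compatible_monoid_rel (op : A -> A -> A) :
  (forall m m' x x' y y', le m one -> le m' one ->
    le (mul m x) y -> le (mul m y) x -> le (mul m' x') y' ->
    le (mul (mul m m') (op x x')) (op y y')) ->
  compatible monoid_rel op.
Proof.
move=> opP x y x' y' [m [Mm xy yx]] [m' [Mm' xy' yx']].
by exists (mul m m'); split; [exact: MM | apply: opP | apply: opP]; auto.
Qed.

Lemma congruence_monoid_rel : congruence monoid_rel.
Proof.
split.
- by move=> x; exists one; split=> //; rewrite mul1x; exact: le_refl.
- exact: monoid_rel_sym.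
- move=> x y z [m [Mm xy yx]] [m' [Mm' yz zy]].
  exists (mul m m'); split; first exact: MM.
  + by rewrite -mulA mulCA; apply: le_trans (le_mull _ xy) yz.
  + by rewrite -mulA; apply: le_trans (le_mull _ zy) yx.
- apply: compatible_monoid_rel => m m' x x' y y' m1 m1' xy _ xy'.
  apply: le_meet.
  + apply: le_trans xy.
    by apply: le_mul; [exact: mul_negr | exact: meet_le_l].
  + apply: le_trans xy'.
    by apply: le_mul; [exact: mul_negl | exact: meet_le_r].
- apply: compatible_monoid_rel => m m' x x' y y' m1 m1' xy _ xy'.
  apply: mul_join_le.
  + apply: le_trans (le_join_l _ _); apply: le_trans xy.
    by apply: le_mul; [exact: mul_negr | exact: le_refl].
  + apply: le_trans (le_join_r _ _); apply: le_trans xy'.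
    by apply: le_mul; [exact: mul_negl | exact: le_refl].
- apply: compatible_monoid_rel => m m' x x' y y' _ _ xy _ xy'.
  by rewrite mulACA; exact: le_mul.
- apply: compatible_monoid_rel => m m' x x' y y' _ _ _ yx xy'.
  (* Chains [m y <= x], [x (x -> x') <= x'] and [m' x' <= y']. *)
  apply: (proj1 (le_mul_imp _ _ _)); apply: le_trans xy'.
  rewrite -mulA mulA (mulC y) mulCA; apply: le_mull.
  by apply: le_trans (mul_imp_le x x'); apply: le_mul yx (le_refl _).
Qed.

End NegativeMonoid.

(** * Quotient algebras *)

Section Congruence.
Variables (A : FLe) (R : A -> A -> Prop) (cR : congruence R).

(** Residuation is an equivalence between equations, not an equation, so it does not pass to the
    quotient by mere rewriting. In each direction a congruent element is found for which the
    inequality holds exactly in [A]. *)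
Lemma cong_residuation x y z :
  R (meet (mul x y) z) (mul x y) <-> R (meet y (imp x z)) y.
Proof.
split=> [Rxyz | Ryxz].
(* [w] replaces [y]: it is congruent to [y], and [x w <= z] holds in [A]. *)
- pose w := meet y (imp x (meet (mul x y) z)).
  have Rwy : R w y.
    have yE : meet y (imp x (mul x y)) = y by apply/le_mul_imp/le_refl.
    rewrite -{1}yE /w.
    by apply: (cong_meet cR); [apply: cong_refl | apply: (cong_imp cR) => //;
       apply: cong_refl].
  have wz : meet w (imp x z) = w.
    apply: le_trans (meet_le_r _ _) _; apply: le_imp; exact: meet_le_r.
  apply: (cong_trans cR) (Rwy); rewrite -wz.
  by apply: (cong_meet cR); [exact: (cong_sym cR) | exact: cong_refl].
- have Rxy : R (mul x (meet y (imp x z))) (mul x y).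
    by apply: (cong_mul cR) => //; apply: cong_refl.
  apply: (cong_trans cR) (Rxy).
  have <- : meet (mul x (meet y (imp x z))) z = mul x (meet y (imp x z)).
    by apply/le_mul_imp; exact: meet_le_r.
  apply: (cong_meet cR); last exact: cong_refl.
  by apply: (cong_mul cR); [apply: cong_refl | apply: (cong_sym cR)].
Qed.

(** Classes are predicates, so by extensionality congruent elements have equal classes. *)
Definition quot_carrier : Type := {P : A -> Prop | exists x, P = R x}.

Definition pi (x : A) : quot_carrier :=
  exist _ (R x) (ex_intro _ x erefl).

Definition repr (q : quot_carrier) : A := projT1 (cid (proj2_sig q)).

Lemma piP x y : pi x = pi y <-> R x y.
Proof.
split=> [[Rxy] | Rxy]; first by rewrite Rxy; exact: cong_refl.
apply: eq_exist; apply: funext => z; apply: propext.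
split; apply: (cong_trans cR) => //; exact: (cong_sym cR).
Qed.

Lemma reprK q : pi (repr q) = q.
Proof.
by case: q => P RP; rewrite /repr; case: cid => x /= Px; exact: eq_exist.
Qed.

Lemma repr_pi x : R (repr (pi x)) x.
Proof. by apply/piP; rewrite reprK. Qed.

Definition quot_op (op : A -> A -> A) (p q : quot_carrier) : quot_carrier :=
  pi (op (repr p) (repr q)).

Lemma quot_opE op x y :
  compatible R op -> quot_op op (pi x) (pi y) = pi (op x y).
Proof. by move=> cop; apply/piP; apply: cop; exact: repr_pi. Qed.

Lemma pi_surj q : exists x, q = pi x.
Proof. by exists (repr q); rewrite reprK. Qed.

Definition quotFLe : FLe.
Proof.
pose E := (quot_opE _ _ (cong_meet cR), quot_opE _ _ (cong_join cR),
  quot_opE _ _ (cong_mul cR), quot_opE _ _ (cong_imp cR)).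
refine (@MkFLe quot_carrier (quot_op meet) (quot_op join) (pi top) (pi bot)
  (quot_op mul) (pi one) (quot_op imp) (pi zero) _ _ _ _ _ _ _ _ _ _ _ _).
- move=> p q r; have [[x ->] [y ->] [z ->]] :=
    And3 (pi_surj p) (pi_surj q) (pi_surj r).
  by rewrite !E meetA.
- move=> p q; have [[x ->] [y ->]] := conj (pi_surj p) (pi_surj q).
  by rewrite !E meetC.
- move=> p q r; have [[x ->] [y ->] [z ->]] :=
    And3 (pi_surj p) (pi_surj q) (pi_surj r).
  by rewrite !E joinA.
- move=> p q; have [[x ->] [y ->]] := conj (pi_surj p) (pi_surj q).
  by rewrite !E joinC.
- move=> p q; have [[x ->] [y ->]] := conj (pi_surj p) (pi_surj q).
  by rewrite !E meet_joinK.
- move=> p q; have [[x ->] [y ->]] := conj (pi_surj p) (pi_surj q).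
  by rewrite !E join_meetK.
- by move=> p; have [x ->] := pi_surj p; rewrite !E le_top.
- by move=> p; have [x ->] := pi_surj p; rewrite !E bot_le.
- move=> p q r; have [[x ->] [y ->] [z ->]] :=
    And3 (pi_surj p) (pi_surj q) (pi_surj r).
  by rewrite !E mulA.
- move=> p q; have [[x ->] [y ->]] := conj (pi_surj p) (pi_surj q).
  by rewrite !E mulC.
- by move=> p; have [x ->] := pi_surj p; rewrite !E mul1x.
- move=> p q r; have [[x ->] [y ->] [z ->]] :=
    And3 (pi_surj p) (pi_surj q) (pi_surj r).
  rewrite !E; split=> /piP/cong_residuation Rxyz; exact/piP.
Defined.

Lemma hom_pi : hom (pi : A -> quotFLe).
Proof.
split=> // x y; apply/esym/quot_opE.
- exact: cong_meet.
- exact: cong_join.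
- exact: cong_mul.
- exact: cong_imp.
Qed.

End Congruence.

(** * Homomorphisms, products and preservation of equations *)

Lemma eval_hom (A B : FLe) (f : A -> B) (v : nat -> A) t :
  hom f -> eval (f \o v) t = f (eval v t).
Proof.
case=> fmeet fjoin ftop fbot fmul fone fimp fzero.
by elim: t => //= [s -> u ->|s -> u ->|s -> u ->|s -> u ->].
Qed.

(** A valuation in the quotient lifts to [A] through chosen representatives. *)
Lemma satisfies_quot (A : FLe) (R : A -> A -> Prop) (cR : congruence R) e :
  satisfies A e -> satisfies (quotFLe cR) e.
Proof.
move=> Ae v; have -> : v = (pi R : A -> quotFLe cR) \o (@repr A R \o v).
  by apply: funext => i /=; rewrite reprK.
by rewrite !(eval_hom _ _ (hom_pi cR)) Ae.
Qed.

Lemma hom_proj (I : Type) (B : I -> FLe) i :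
  hom (fun x : prodFLe B => x i).
Proof. by []. Qed.

Lemma hom_prod (A : FLe) (I : Type) (B : I -> FLe) (f : forall i, A -> B i) :
  (forall i, hom (f i)) -> hom (fun x => (fun i => f i x) : prodFLe B).
Proof.
move=> fh; split=> [x y|x y|||x y||x y|]; apply: functional_extensionality_dep => i /=.
- exact: hom_meet.
- exact: hom_join.
- exact: hom_top.
- exact: hom_bot.
- exact: hom_mul.
- exact: hom_one.
- exact: hom_imp.
- exact: hom_zero.
Qed.

Lemma hom_comp (A B C : FLe) (g : B -> C) (f : A -> B) :
  hom g -> hom f -> hom (g \o f).
Proof.
move=> [gmeet gjoin gtop gbot gmul gone gimp gzero].
case=> fmeet fjoin ftop fbot fmul fone fimp fzero; split.
- by move=> x y; rewrite /= fmeet gmeet.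
- by move=> x y; rewrite /= fjoin gjoin.
- by rewrite /= ftop gtop.
- by rewrite /= fbot gbot.
- by move=> x y; rewrite /= fmul gmul.
- by rewrite /= fone gone.
- by move=> x y; rewrite /= fimp gimp.
- by rewrite /= fzero gzero.
Qed.

Lemma satisfies_prod (I : Type) (B : I -> FLe) e :
  (forall i, satisfies (B i) e) -> satisfies (prodFLe B) e.
Proof.
move=> Be v; apply: functional_extensionality_dep => i.
by rewrite -!(eval_hom _ _ (hom_proj B i)) Be.
Qed.

Lemma hom_pow (A B : FLe) (f : A -> B) (x : A) n :
  hom f -> f (pow x n) = pow (f x) n.
Proof.
by move=> fh; elim: n => [|n IHn] /=; rewrite ?(hom_one fh) ?(hom_mul fh) ?IHn.
Qed.

Lemma eval_pow (A : FLe) (v : nat -> A) t n :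
  eval v (Pow t n) = pow (eval v t) n.
Proof. by elim: n => //= n ->. Qed.

(** * Simple algebras and inequalities in semisimple ones *)

Lemma congruence_eq (A : FLe) : congruence (@eq A).
Proof.
by split=> // [x y z -> //|x x' y y' -> ->|x x' y y' -> ->|x x' y y' -> ->
  |x x' y y' -> ->].
Qed.

Lemma congruence_total (A : FLe) : congruence (fun _ _ : A => True).
Proof. by []. Qed.

(** A congruence relating [bot] and [one] is total: multiplying by [z] relates [bot] and [z]. *)
Lemma simpleP (A : FLe) : simple A <->
  (bot : A) <> one /\ (forall R : A -> A -> Prop, congruence R ->
    (forall x y, R x y -> x = y) \/ R bot one).
Proof.
split=> [[R [S [cR cS nRS RSP]]] | [nt triv]].
- have [eqP totP] := (RSP _ (congruence_eq A), RSP _ (congruence_total A)).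
  have eqtot : (bot : A) <> one.
    move=> b1; apply: nRS; have tr (x y : A) : x = y.
      have xb (z : A) : z = bot.
        by rewrite -(mulx1 z) -b1 mulx_bot.
      by rewrite (xb x) (xb y).
    by move=> x y; rewrite (tr x y); split=> _; exact: cong_refl.
  (* Equality and the total relation differ because [bot <> one], so they are [R] and [S] in some
     order, and [Q] is one of them. *)
  split=> // Q cQ; case: (RSP _ cQ) => QE.
  + case: eqP => E; first by left=> x y /QE/E.
    case: totP => T; last by case: eqtot; apply/E/T.
    by right; apply/QE/T.
  + case: eqP => E; last by left=> x y /QE/E.
    case: totP => T; first by case: eqtot; apply/E/T.
    by right; apply/QE/T.
- exists eq, (fun _ _ => True); split; [exact: congruence_eq | by [] | |].
    by move=> /(_ bot one) [_ /(_ I)].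
  move=> Q cQ; case: (triv Q cQ) => [Qeq | Qb1]; [left | right] => x y.
    by split=> [/Qeq // | ->]; exact: cong_refl.
  have Qbx z : Q bot z.
    rewrite -(mulx1 z) -(mulx_bot z).
    by apply: (cong_mul cQ) => //; exact: cong_refl.
  split=> // _; apply: (cong_trans cQ) (Qbx y); exact: (cong_sym cQ).
Qed.

(** The powers of [e] form a negative monoid whose congruence relates [e] to [one]. If it is
    equality, [e = one]; if it relates [bot] to [one], some power lies below [bot]. *)
Lemma simple_pow (A : FLe) (e : A) :
  simple A -> le e one -> e = one \/ exists n, pow e n = bot.
Proof.
move=> /simpleP[_ triv] e1; pose M m := exists n, m = pow e n.
have cM : congruence (monoid_rel M).
  apply: congruence_monoid_rel.
  - by exists 0.
  - by move=> _ _ [n ->] [p ->]; exists (n + p); rewrite powD.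
  - by move=> _ [n ->]; exact: pow_le1.
case: (triv _ cM) => [Meq | [_ [[n ->] _ en]]].
- left; apply: Meq; exists e; split; first by exists 1; rewrite /= mul1x.
  + exact: le_trans (mul_negl _ e1) e1.
  + by rewrite mulx1; exact: le_refl.
- by right; exists n; apply: le_anti (bot_min _); rewrite mulx1 in en.
Qed.

Definition neg (A : FLe) (x : A) : A := imp x bot.

(** Checked in each simple factor: either [e] becomes [one], and [e <= b] suffices, or some [e^n]
    becomes [bot], whose negation is above [one]. *)
Lemma semisimple_le (A : FLe) (e b : A) : semisimple A -> le e one ->
  le e b -> (forall n, le (meet one (neg (pow e n))) b) -> le one b.
Proof.
move=> [I [B [h [sB [hh hinj _]]]]] e1 eb nb; apply: hinj.
apply: functional_extensionality_dep => i.
have {}hh : hom (fun x => h x i).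
  exact: hom_comp (hom_proj B i) hh.
pose g x := h x i; rewrite -!/(g _); rewrite -/g in hh.
have gle x y : le x y -> le (g x) (g y) by rewrite /le -(hom_meet hh) => ->.
rewrite (hom_meet hh) (hom_one hh); apply: (@le_trans _ one); first exact: le_refl.
have := gle _ _ e1; rewrite (hom_one hh) => /(simple_pow (sB i)) [ge1 | [n gn]].
  by rewrite -ge1; exact: gle.
apply: le_trans (gle _ _ (nb n)).
rewrite (hom_meet hh) (hom_one hh) /neg (hom_imp hh) hom_pow // gn (hom_bot hh).
apply: le_meet; [exact: le_refl | apply/le_mul_imp].
by rewrite mulx1; exact: le_refl.
Qed.

(** * Simple quotients from maximal avoiding monoids *)

Section Maximal.
Variables (A : FLe) (n : nat) (em : satisfies A (excluded_middle_eq n)).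

Lemma satisfies_em (c : A) : le c one -> join c (meet one (neg (pow c n))) = one.
Proof. by rewrite /le meetC => c1; have := em (fun=> c); rewrite /= eval_pow /= c1. Qed.

Variable a : A.
Hypothesis a1 : ~ le one a.

(* [one] is not required to be in [M], so that the union of the empty chain is
   admissible in Zorn's lemma. *)
Definition avoiding (M : set A) : Prop :=
  [/\ forall m m', M m -> M m' -> M (mul m m'), forall m, M m -> le m one &
      forall m, M m -> ~ le m a].

Lemma exists_maximal_avoiding : exists M, [/\ avoiding M, M one &
  forall c, le c one -> ~ M c -> exists m k, M m /\ le (mul m (pow c k)) a].
Proof.
have [F Fav Ftot | M [[MM Mneg Ma] Mmax]] := @Zorn_bigcup A avoiding.
  split=> [m m' [X FX Xm] [Y FY Ym'] | m [X FX Xm] | m [X FX Xm]].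
  - case: (Ftot X Y FX FY) => sub; [exists Y | exists X] => //.
      by have [YM _ _] := Fav _ FY; apply: YM => //; exact: sub.
    by have [XM _ _] := Fav _ FX; apply: XM => //; exact: sub.
  - by have [_ neg _] := Fav _ FX; exact: neg.
  - by have [_ _ av] := Fav _ FX; exact: av.
have M1 : M one.
  apply: contrapT => nM1; apply: (Mmax (M `|` [set one])%classic).
    split; first by move=> x; left.
    by move=> /(_ one) sub; apply/nM1/sub; right.
  split=> [m m' | m | m].
  - case=> [Mm | ->]; last by rewrite mul1x.
    by case=> [Mm' | ->]; rewrite ?mulx1; left=> //; exact: MM.
  - by case=> [/Mneg // | ->]; exact: le_refl.
  - by case=> [/Ma // | ->].
exists M; split=> // c c1 nMc; apply: contrapT => nex.
(* The monoid generated by [M] and [c] properly contains [M], so by maximality it must meet the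
   elements below [a]. *)
pose M' : set A := fun x => exists m k, M m /\ x = mul m (pow c k).
apply: (Mmax M').
  split; first by move=> x Mx; exists x, 0; rewrite /= mulx1.
  by move=> /(_ c) sub; apply/nMc/sub; exists one, 1; rewrite /= !mul1x.
split=> [_ _ [m [k [Mm ->]]] [m' [k' [Mm' ->]]] | _ [m [k [Mm ->]]] |
         _ [m [k [Mm ->]]] ma].
- by exists (mul m m'), (k + k'); rewrite powD mulACA; split=> //; exact: MM.
- by apply: le_trans (Mneg _ Mm); apply: mul_negr; exact: pow_le1.
- by apply: nex; exists m, k.
Qed.

Lemma exists_simple_quot : exists (R : A -> A -> Prop) (cR : congruence R),
  simple (quotFLe cR) /\ ~ R (meet one a) one.
Proof.
have [M [[MM Mneg Ma] M1 Mmax]] := exists_maximal_avoiding.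
have cR := congruence_monoid_rel M1 MM Mneg.
have Rone c : M c -> monoid_rel M c one.
  move=> Mc; exists c; split=> //; first by apply: le_trans (mul_negl _ _) _; exact: Mneg.
  by rewrite mulx1; exact: le_refl.
have avoid c : le c a -> ~ monoid_rel M c one.
  by move=> ca [m [Mm _]]; rewrite mulx1 => mc; apply: (Ma m Mm); exact: le_trans ca.
exists (monoid_rel M), cR; split; last first.
  by apply: avoid; exact: meet_le_r.
apply/simpleP; split; first by move=> /(piP cR); apply: avoid; exact: bot_min.
move=> Q cQ; have [mE _ _ bE uE oE iE _] := hom_pi cR.
pose p : A -> quotFLe cR := pi (monoid_rel M).
(* If [Q] identifies with [one] some negative element outside [M], it relates [bot] to [one];
   otherwise it is equality. *)
have [[c [c1 nMc Qc]] | allM] :=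
    pselect (exists c, [/\ le c one, ~ M c & Q (p c) one]).
- right; pose d := meet one (neg (pow c n)).
  have d1 : le d one by exact: meet_le_l.
  have Md : M d.
    apply: contrapT => /(Mmax _ d1) [m' [l [Mm' m'd]]].
    have [m [k [Mm mc]]] := Mmax _ c1 nMc.
    apply: (Ma _ (MM _ _ Mm Mm')).
    apply: (join1_pow_le c1 d1 (satisfies_em c1) (k := k) (l := l)).
    + by apply: le_trans mc; rewrite (mulC m) -mulA; apply: mul_negl; exact: Mneg.
    + by apply: le_trans m'd; rewrite -mulA; apply: mul_negl; exact: Mneg.
  have Qpow k : Q (pow (p c) k) one.
    elim: k => [|k IHk] /=; first exact: (cong_refl cQ).
    by have := cong_mul cQ IHk Qc; rewrite mul1x.
  have cd : mul (pow c n) d = bot.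
    apply: le_anti (bot_min _); apply/le_mul_imp; exact: meet_le_r.
  have pd : p d = one by apply/(piP cR); exact: Rone.
  (* As [p d = one], the power [(p c)^n] equals [p (c^n d)], which is [bot]. *)
  have := Qpow n; rewrite -(hom_pow _ _ (hom_pi cR)) -[pi _ _](@mulx1 (quotFLe cR)).
  by rewrite -{1}pd -uE cd bE.
- left=> p1 p2; have [[x ->] [y ->]] := conj (pi_surj p1) (pi_surj p2) => Qxy.
  (* The negative part of the biresiduum of [x] and [y]. Replacing [y] by [x] turns it into [one],
     so [Q] relates [p e] to [one], whence [M e]; and [e] witnesses that [x] and [y] are congruent
     modulo [M]. *)
  pose e := meet one (meet (imp x y) (imp y x)).
  have Me : M e.
    apply: contrapT => nMe; apply: allM; exists e; split=> //.
      exact: meet_le_l.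
    have id1 z : le one (imp z z) by apply/le_mul_imp; rewrite mulx1; exact: le_refl.
    have -> : (one : quotFLe cR) =
        p (meet one (meet (imp x x) (imp x x))) by rewrite meetxx id1.
    rewrite /p /e !mE !iE; apply: (cong_meet cQ); first exact: (cong_refl cQ).
    have Qyx := cong_sym cQ Qxy; have Qxx := cong_refl cQ (p x).
    by apply: (cong_meet cQ); apply: (cong_imp cQ).
  apply/(piP cR); exists e; split=> //; rewrite mulC; apply/le_mul_imp.
  + exact: le_trans (meet_le_r _ _) (meet_le_l _ _).
  + exact: le_trans (meet_le_r _ _) (meet_le_r _ _).
Qed.

End Maximal.

(** The factors are all simple quotients of [A]. If [x <= y] fails, then [x -> y] is not above
    [one], and the simple quotient obtained for [a := x -> y] separates [x] from [y], since
    identifying them would send [1 /\ (x -> y)] to [one]. *)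
Lemma em_semisimple (A : FLe) n :
  satisfies A (excluded_middle_eq n) -> semisimple A.
Proof.
move=> em.
pose I := {R : A -> A -> Prop | exists cR : congruence R, simple (quotFLe cR)}.
pose cI (i : I) := projT1 (cid (proj2_sig i)).
have sI i : simple (quotFLe (cI i)) := projT2 (cid (proj2_sig i)).
exists I, (fun i => quotFLe (cI i)), (fun x i => pi (proj1_sig i) x); split=> //.
split.
- exact: (hom_prod (fun i => hom_pi (cI i))).
- have sep x y : (forall i : I, proj1_sig i x y) -> le x y.
    move=> xy; apply: contrapT => nxy.
    have [|R [cR [sR]]] := exists_simple_quot em (a := imp x y).
      by move=> /le_mul_imp; rewrite mulx1.
    apply; have Rxy : R x y := xy (exist _ R (ex_intro _ cR sR)).
    have {2}<- : meet one (imp x x) = one.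
      by apply/le_mul_imp; rewrite mulx1; exact: le_refl.
    apply: (cong_meet cR); first exact: cong_refl.
    by apply: (cong_imp cR); [exact: cong_refl | exact: (cong_sym cR)].
  move=> x y xy; have Rxy (i : I) : proj1_sig i x y.
    by apply/(piP (cI i)); exact: (f_equal (fun u => u i) xy).
  by apply: le_anti; apply: sep => // i; apply: (cong_sym (cI i)).
- by move=> i q; have [x ->] := pi_surj q; exists x.
Qed.

(** * The reduced product modulo the cofinite filter, and the equivalence *)

Definition eventually_eq (B : nat -> FLe) (x y : prodFLe B) : Prop :=
  exists N, forall n, N <= n -> x n = y n.

Lemma congruence_eventually_eq (B : nat -> FLe) :
  congruence (@eventually_eq B).
Proof.
have compat (op : forall n, B n -> B n -> B n) :
    compatible (@eventually_eq B) (fun x y n => op n (x n) (y n)).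
  move=> x x' y y' [N xx'] [N' yy']; exists (maxn N N') => n.
  by rewrite geq_max => /andP[/xx' -> /yy' ->].
split.
- by move=> x; exists 0.
- by move=> x y [N xy]; exists N => n /xy.
- move=> x y z [N xy] [N' yz]; exists (maxn N N') => n.
  by rewrite geq_max => /andP[/xy -> /yz ->].
- exact: (compat (fun=> meet)).
- exact: (compat (fun=> join)).
- exact: (compat (fun=> mul)).
- exact: (compat (fun=> imp)).
Qed.

Theorem corollary3p46 (V : FLe -> Prop) (varV : is_variety V) :
  class_semisimple V <->
  exists n : nat, class_satisfies V (excluded_middle_eq n).
Proof.
split=> [ssV | [n em] A VA]; last exact: em_semisimple (em A VA).
apply: contrapT => nem.
have fail n : exists Av : {A : FLe & nat -> A}, V (tag Av) /\
    eval (tagged Av) (excluded_middle_eq n).1 <> one.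
  apply: contrapT => nfail; apply: nem; exists n => A VA v; apply: contrapT => ne.
  by apply: nfail; exists (Tagged (fun A : FLe => nat -> A) v).
pose B n := tag (projT1 (cid (fail n))).
pose a n : B n := tagged (projT1 (cid (fail n))) 0.
have VB n : V (B n) by have [] := projT2 (cid (fail n)).
pose e : prodFLe B := fun n => meet one (a n).
pose b : prodFLe B := fun n => join (e n) (meet one (neg (pow (e n) n))).
have bne n : b n <> one.
  have [_] := projT2 (cid (fail n)).
  by rewrite /= eval_pow.
have e1 n : le (e n) one by exact: meet_le_l.
pose cR := congruence_eventually_eq B.
have VQ : V (quotFLe cR).
  have [E VE] := varV; apply/VE => eq Eeq.
  by apply/satisfies_quot/satisfies_prod => n; move: eq Eeq; apply/VE.
have hp := hom_pi cR; pose p : _ -> quotFLe cR := pi _.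
have ple x y : eventually_eq (meet x y) x -> le (p x) (p y).
  by move=> xy; rewrite /le -(hom_meet hp); apply/piP.
have : le (p one) (p b).
  apply: (semisimple_le (e := p e) (ssV _ VQ)).
  - by apply: ple; exists 0 => n _; exact: e1.
  - by apply: ple; exists 0 => n _; exact: le_join_l.
  (* From index [k] on, [e^n <= e^k] gives [~ e^k <= ~ e^n], and the latter enters [b n]. *)
  - move=> k; rewrite -(hom_pow _ _ hp) /neg -(hom_bot hp) -(hom_imp hp).
    rewrite -(hom_one hp) -(hom_meet hp); apply: ple; exists k => n kn.
    apply: le_trans (le_join_r _ _); rewrite /= (hom_pow _ _ (hom_proj B n)).
    apply: le_meet; first exact: meet_le_l.
    apply: le_trans (meet_le_r _ _) _; apply/le_mul_imp.
    apply: le_trans (mul_imp_le (pow (e n) k) bot).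
    by apply: le_mul; [exact: le_pow | exact: le_refl].
(* The inequality in the quotient holds in coordinate [N] of the product, where [b N <= 1] then
   forces [b N = 1]. *)
rewrite /le -(hom_meet hp) => /(piP cR) [N /(_ N (leqnn N)) bN].
apply: (bne N); apply: le_anti => //.
by apply: join_le => //; exact: meet_le_l.
Qed.
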